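(* Let $G$ be a finite simple graph of treewidth at most $k$ and maximum degree $\Delta \geq k + \sqrt{k}$. Then $G$ is not overfull.
   Context: All graphs are finite and simple. $\Delta(G)$ denotes the maximum degree of $G$. A graph $G$ is overfull if it has an odd number $n$ of vertices and strictly more than $\Delta(G)\tfrac{n-1}{2}$ edges. A tree-decomposition of $G$ consists of a tree $T$ and a collection of bags $B_t \subseteq V(G)$, $t\in V(T)$, such that (i) $V(G)=\bigcup_{t\in V(T)} B_t$; (ii) for each edge $vw\in E(G)$ there is $t\in V(T)$ with $v,w\in B_t$; (iii) if $v\in B_s\cap B_t$ then $v\in B_r$ for every vertex $r$ on the path connecting $s$ and $t$ in $T$. It has width $k$ if each bag has size at most $k+1$. The treewidth of $G$ is the smallest integer $k$ for which there is a width $k$ tree-decomposition of $G$. *)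

(* Defs.v *)
From mathcomp Require Import all_boot boolp.

Set Implicit Arguments.
Unset Strict Implicit.
Unset Printing Implicit Defensive.

Record sgraph := SGraph {
  vertex :> finType;
  adj : rel vertex;
  adj_sym : symmetric adj;
  adj_irrefl : irreflexive adj }.

Arguments adj {s}.

Definition edges (G : sgraph) : {set {set G}} :=
  [set [set p.1; p.2] | p : G * G & adj p.1 p.2].

Definition degree (G : sgraph) (x : G) : nat := #|[set y | adj x y]|.

Definition max_degree (G : sgraph) : nat := \max_(x : G) degree x.

(* Since #|G| is odd, the truncated half of #|G| - 1 is exact. *)
Definition overfull (G : sgraph) : Prop :=
  odd #|G| /\ max_degree G * ((#|G| - 1) %/ 2) < #|edges G|.

(* The bound [size c <= 2] excludes exactly the cycles of length at least 3:
   [ucycle] also accepts [::] and, for an edge xy, the sequence [:: x; y]. *)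
Definition is_tree (T : sgraph) : Prop :=
  [/\ 0 < #|T|,
      forall s t : T, connect adj s t
    & forall c : seq T, ucycle adj c -> size c <= 2].

(* In a tree, the path s :: p from s to t in the third clause is unique. *)
Definition tree_decomposition (G T : sgraph) (B : T -> {set G}) : Prop :=
  [/\ is_tree T,
      forall v : G, exists t, v \in B t,
      forall v w : G, adj v w -> exists t, (v \in B t) && (w \in B t)
    & forall (v : G) (s t : T) (p : seq T),
        v \in B s -> v \in B t ->
        path adj s p -> uniq (s :: p) -> last s p = t ->
        forall r, r \in s :: p -> v \in B r].

Definition has_width (G T : sgraph) (B : T -> {set G}) (k : nat) : Prop :=
  forall t, #|B t| <= k + 1.

Definition has_tree_decomposition (G : sgraph) (k : nat) : Prop :=
  exists (T : sgraph) (B : T -> {set G}),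
    tree_decomposition B /\ has_width B k.

Lemma ex_tree_decomposition (G : sgraph) :
  exists k, `[< has_tree_decomposition G k >].
Proof.
have Ks : symmetric (fun _ _ : unit => false) by [].
have Ki : irreflexive (fun _ _ : unit => false) by [].
exists #|G|; apply/asboolP; exists (SGraph Ks Ki), (fun=> [set: G]).
split=> [|t]; last by rewrite cardsT addn1 leqnSn.
split=> [|v|v w _|v s t p _ _ _ _ _ r _]; rewrite ?inE //.
by split=> [|[] []|[|x [|y [|z c]]]] //; rewrite card_unit.
Qed.

(* The minimum is over natural numbers, so the graph without vertices gets
   treewidth 0 rather than -1. *)
Definition treewidth (G : sgraph) : nat := ex_minn (ex_tree_decomposition G).

Lemma treewidth_leP (G : sgraph) (k : nat) :
  treewidth G <= k <-> has_tree_decomposition G k.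
Proof.
rewrite /treewidth; case: ex_minnP => m /asboolP[T [B [dB wB]]] min_m.
split=> [le_mk|Gk]; last by apply: min_m; apply/asboolP.
exists T, B; split=> // t; apply: leq_trans (wB t) _.
by rewrite leq_add2r.
Qed.

(* Main.v *)
(* Write [Delta = k + s], so that [k <= s ^ 2]. As [n] is odd, it suffices that the
   deficits [Delta - deg v] sum to at least [Delta]. Since [n > Delta >= k], the
   tree decomposition makes [G] a subgraph of a [k]-tree [H] on the same vertices,
   and truncated deficits only decrease from [G] to [H]. A [k]-tree with at least
   [k + s + 1] vertices has truncated deficits summing to at least
   [s (s + 1) >= Delta]: a new vertex, attached to a [k]-clique [Q], brings the
   deficit [s] and takes 1 from each vertex of [Q] that had degree less than
   [k + s]; there are at most [s] of those. *)
Require Import Defs.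
From mathcomp Require Import all_boot all_order all_algebra.
From mathcomp Require Import reals.
From mathcomp Require Import zify.

Set Implicit Arguments.
Unset Strict Implicit.
Unset Printing Implicit Defensive.

(** * Edges and the degree sum *)

Lemma double_card_edges_le (G : sgraph) : #|edges G| * 2 <= \sum_(x : G) degree x.
Proof.
pose D := [set p : G * G | adj p.1 p.2].
pose f (p : G * G) := [set p.1; p.2].
have -> : \sum_(x : G) degree x = #|D|.
  rewrite /degree -sum1_card (eq_bigl (fun p => adj p.1 p.2)); last by move=> p; rewrite inE.
  rewrite -(pair_big_dep xpredT (fun x y : G => adj x y) (fun _ _ => 1)) /=.
  by apply: eq_bigr => x _; rewrite sum1dep_card.
have edgesE : edges G = f @: D.
  by apply/setP => E; apply/imsetP/imsetP => -[p]; rewrite ?inE => ap ->; exists p; rewrite ?inE.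
have -> : #|D| = \sum_(E in f @: D) #|[set p in D | f p == E]|.
  rewrite -sum1_card (partition_big_imset f) /=.
  by apply: eq_bigr => E _; rewrite sum1dep_card; apply: eq_card => p; rewrite !inE.
rewrite edgesE -sum_nat_const; apply: leq_sum => _ /imsetP[[a b] + ->].
rewrite inE /= => ab.
have abN : a != b by apply: contraTneq ab => ->; rewrite adj_irrefl.
(* Both orderings of an edge lie in its fibre, and they differ as there are no loops. *)
have -> : 2 = #|[set (a, b); (b, a)]| by rewrite cards2 xpair_eqE negb_and abN.
apply/subset_leq_card/subsetP => p; rewrite !inE => /orP[]/eqP->; rewrite /= ?ab ?eqxx //.
by rewrite adj_sym ab /f /= setUC eqxx.
Qed.

(** * Convex node sets of the decomposition tree and their gates *)

Section Gates.

Variable T : sgraph.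
Hypothesis T_connected : forall s t : T, connect adj s t.

Implicit Types (C : {set T}) (r q z : T).

Definition convex (C : {set T}) : Prop :=
  forall s t p, s \in C -> t \in C -> path adj s p -> uniq (s :: p) ->
    last s p = t -> forall r, r \in s :: p -> r \in C.

(** Each component left after deleting the edges inside a convex nonempty [C] meets [C] in exactly
    one node: the gate of that component's nodes. *)
Definition adj_off (C : {set T}) : rel T :=
  fun x y => adj x y && ~~ ((x \in C) && (y \in C)).

Lemma connect_adj_off_sym C : connect_sym (adj_off C).
Proof.
by apply: sym_connect_sym => x y; rewrite /adj_off adj_sym [(x \in C) && _]andbC.
Qed.

Lemma sub_adj_off C : subrel (adj_off C) adj.
Proof. by move=> x y /andP[]. Qed.

(** By convexity a simple path between two nodes of [C] stays in [C], so its first edge would be a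
    deleted one. *)
Lemma gate_unique C x y :
  convex C -> x \in C -> y \in C -> connect (adj_off C) x y -> x = y.
Proof.
move=> cC xC yC /connectP[p0 pth0 ey]; move: yC; rewrite {y}ey.
case: (shortenP pth0) => -[//|w p] pth up _ yC.
have wC : w \in C.
  apply: (cC _ _ _ xC yC (sub_path (@sub_adj_off C) pth) up erefl).
  by rewrite !inE eqxx orbT.
by case/andP: pth => /andP[_]; rewrite xC wC.
Qed.

Lemma gate_exists C r c :
  c \in C -> exists2 q, q \in C & connect (adj_off C) r q.
Proof.
move=> cC; have /connectP[p] := T_connected r c.
elim: p r => [|r' p IHp] r /=; first by move=> _ <-; exists c.
case/andP=> rr' pth ec; have [rC|rC] := boolP (r \in C); first by exists r.
have [q qC r'q] := IHp _ pth ec.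
by exists q => //; apply: connect_trans r'q; apply: connect1; rewrite /adj_off rr' (negbTE rC).
Qed.

(** A simple path from [z] to its gate [q] meets [C] only in [q]. Continued by a simple path from
    [q] to [p], which stays in [C], it is a simple path between two nodes of [C'], so convexity of
    [C'] catches [q]. *)
Lemma gate_mem C C' p q z :
    convex C -> convex C' -> p \in C -> p \in C' -> q \in C -> z \in C' ->
  connect (adj_off C) z q -> q \in C'.
Proof.
move=> cC cC' pC pC' qC zC' zq.
have /connectP[p0 pth0 eq0] := zq.
case: (shortenP pth0) eq0 => p1 pth1 u1 _ eq1.
have /connectP[p3 pth3 eq3] := T_connected q p.
case: (shortenP pth3) eq3 => p2 pth2 u2 _ eq2.
have /andP[qp2 up2] : (q \notin p2) && uniq p2 by [].
have in1 w : w \in z :: p1 -> w \in C -> w = q.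
  move=> w1 wC; apply: (gate_unique cC wC qC).
  by apply: connect_trans zq; rewrite connect_adj_off_sym (path_connect pth1).
have in2 w : w \in p2 -> w \in C.
  by move=> w2; apply: (cC q p p2) => //; rewrite inE w2 orbT.
have u12 : uniq (z :: (p1 ++ p2)).
  rewrite -cat_cons cat_uniq u1 up2 andbT /=.
  apply/hasPn => w w2; apply/negP => w1.
  by move: qp2; rewrite -(in1 w w1 (in2 w w2)) w2.
apply: (cC' z p (p1 ++ p2)) => //.
- by rewrite cat_path -eq1 pth2 (sub_path (@sub_adj_off C) pth1).
- by rewrite last_cat -eq1.
- by rewrite -cat_cons mem_cat eq1 mem_last.
Qed.

(* The nodes reached from [r] without following an edge of the subtree [C]; in a
   rooted tree, this set grows with the depth of the top node of [C]. *)
Definition front (r : T) (C : {set T}) : {set T} :=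
  [set w | connect (adj_off C) r w].

(** By [gate_mem], [front r C] misses [C'], so the walks that define it use no edge inside [C']. The
    gate of [r] in [C'] is then a new element. *)
Lemma front_proper r C C' p q :
    convex C -> convex C' -> p \in C -> p \in C' -> q \in front r C -> q \in C ->
  q \notin C' -> front r C \proper front r C'.
Proof.
move=> cC cC' pC pC'; rewrite inE => rq qC qC'.
have offC' z : connect (adj_off C) r z -> z \notin C'.
  move=> rz; apply: contra qC' => zC'; apply: (gate_mem cC cC' pC pC' qC zC').
  by apply: connect_trans rq; rewrite connect_adj_off_sym.
apply/properP; split; last first.
  have [q' q'C' rq'] := gate_exists r pC'.
  by exists q'; rewrite inE //; apply: contraL q'C'; apply: offC'.
apply/subsetP => w; rewrite !inE => /connectP[l + ->].
have := connect0 (adj_off C) r; have := connect0 (adj_off C') r.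
(* Only the current node of the walk is generalised: [a] moves while [r] stays the root. *)
move: {2 4 5 7}r => a; elim: l a => [//|b l IHl] a /= ra' ra /andP[ab pth].
apply: (IHl _ _ _ pth); last exact: (connect_trans ra (connect1 ab)).
apply: (connect_trans ra'); apply: connect1.
by rewrite /adj_off (@sub_adj_off C _ _ ab) (negbTE (offC' _ ra)).
Qed.

End Gates.

(** * The chordal supergraph given by a tree decomposition *)

Section Share.

Variables (G T : sgraph) (B : T -> {set G}).
Hypothesis tdB : tree_decomposition B.

Definition share : rel G := fun x y => [exists t, (x \in B t) && (y \in B t)].

Lemma share_refl : reflexive share.
Proof.
case: tdB => _ cov _ _ x; have [t xt] := cov x.
by apply/existsP; exists t; rewrite xt.
Qed.

Lemma share_sym : symmetric share.
Proof. by move=> x y; apply: eq_existsb => t; rewrite andbC. Qed.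

Lemma adj_share (x y : G) : adj x y -> share x y.
Proof. by case: tdB => _ _ cov _ xy; apply/existsP; apply: cov. Qed.

(* Maximising the front of a vertex amounts to taking its subtree as far from the
   root as possible; every subtree meeting it then contains its gate. *)
Lemma share_simplicial (S : {set G}) : S != set0 ->
  exists2 x, x \in S & exists q, forall u, u \in S -> share x u -> u \in B q.
Proof.
case/set0Pn => v vS; have [[T0 Tc _] cov _ convB] := tdB.
have [r _] := card_gt0P T0.
pose C (x : G) : {set T} := [set t | x \in B t].
have cC x : convex (C x).
  move=> s t p; rewrite !inE => xs xt pth up e z zp; rewrite inE.
  exact: (convB x s t p).
case: (arg_maxnP (fun x => #|front r (C x)|) vS) => x xS x_max.
exists x => //; have [t xt] := cov x.
have tC : t \in C x by rewrite inE.
(* With [T] rooted at [r], this is the top node of the subtree of [x]. *)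
have [q qC rq] := gate_exists Tc r tC.
exists q => u uS /existsP[p /andP[xp up]].
apply: contraT => uq; have : #|front r (C u)| <= #|front r (C x)| := x_max u uS.
rewrite leqNgt => /negP[].
apply/proper_card/(@front_proper _ Tc r _ _ p q); rewrite ?inE //.
by move: qC; rewrite inE.
Qed.

End Share.

(** * [k]-trees and their cliques *)

Section KTree.

Variables (V : finType) (k : nat).
Implicit Types (e : rel V) (S Q C : {set V}).

Definition clique e Q := {in Q &, forall x y, e x y}.

Definition attach e (v : V) Q : rel V := fun x y =>
  if x == v then y \in v |: Q else if y == v then x \in Q else e x y.

(* The adjacency relation of a [k]-tree is taken reflexive, so that cliques are the
   sets on which it is total; [closed_degree] is then the degree plus one. *)
Inductive ktree : {set V} -> rel V -> Prop :=
| KTreeBase S e of #|S| = k.+1 & clique e S : ktree S e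
| KTreeAttach S e v Q of ktree S e & v \notin S & Q \subset S & #|Q| = k & clique e Q :
    ktree (v |: S) (attach e v Q).

Definition closed_degree e S (u : V) : nat := #|[set w in S | e u w]|.

Lemma attach_old e v S Q : v \notin S -> {in S &, attach e v Q =2 e}.
Proof.
move=> vS x y xS yS; rewrite /attach.
by rewrite !(negPf (memPn vS _ _)).
Qed.

Lemma closed_degree_attach_new e v S Q :
  v \notin S -> Q \subset S -> closed_degree (attach e v Q) (v |: S) v = #|Q|.+1.
Proof.
move=> vS QS; rewrite -[RHS](_ : #|v |: Q| = _); last first.
  by rewrite cardsU1 (contra (subsetP QS v) vS).
apply: eq_card => w; rewrite !inE /attach eqxx !inE.
by case: eqP => //= _; case: (boolP (w \in Q)) => [/(subsetP QS)->//|]; rewrite andbF.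
Qed.

Lemma closed_degree_attach_old e v S Q u : v \notin S -> u \in S ->
  closed_degree (attach e v Q) (v |: S) u = (u \in Q) + closed_degree e S u.
Proof.
move=> vS uS; rewrite /closed_degree (cardsD1 v) !inE eqxx /= /attach eqxx.
rewrite (negPf (memPn vS u uS)); congr (_ + _); apply: eq_card => w; rewrite !inE.
by case: eqP => [->|_] //=; rewrite (negbTE vS).
Qed.

Lemma clique_attach e v S Q : v \notin S -> Q \subset S -> clique e Q ->
  clique (attach e v Q) (v |: Q).
Proof.
move=> vS QS cQ x y; rewrite !inE /attach !inE.
case: (x == v) => //= xQ; case: (y == v) => //= yQ; exact: cQ.
Qed.

Lemma sub_clique e Q C : Q \subset C -> clique e C -> clique e Q.
Proof. by move=> /subsetP QC cC x y /QC xC /QC; apply: cC. Qed.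

Lemma clique_attach_old e v S Q C : v \notin S -> C \subset S ->
  clique (attach e v Q) C <-> clique e C.
Proof.
move=> vS /subsetP CS.
by split=> cC x y xC yC; have := cC x y xC yC; rewrite (attach_old _ _ vS) ?CS.
Qed.

Lemma clique_attach_sub e v S Q C : C \subset v |: S -> v \in C ->
  clique (attach e v Q) C -> C \subset v |: Q.
Proof.
by move=> CS vC cC; apply/subsetP => x xC; have := cC v x vC xC; rewrite /attach eqxx.
Qed.

Lemma subset_setU1_notin (v : V) S C : C \subset v |: S -> v \notin C -> C \subset S.
Proof.
move=> /subsetP CS vC; apply/subsetP => x xC; move: (CS x xC).
by rewrite !inE (negPf (memPn vC x xC)).
Qed.

Lemma ktree_sym S e : ktree S e -> {in S &, symmetric e}.
Proof.
elim=> {S e} [S e _ cS|S e v Q _ IH vS QS _ _] x y.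
  by move=> xS yS; rewrite !cS.
rewrite !inE /attach !inE; case: (eqVneq x v) => [->|xv] /=.
  by case: eqP.
by case: (eqVneq y v) => //= yv; apply: IH.
Qed.

(** A clique through the last vertex [v] lies in the clique [v |: Q'] of size [k.+1]; any other
    clique is already one of the smaller [k]-tree. *)
Lemma ktree_clique_extend S e Q : ktree S e -> Q \subset S -> clique e Q ->
  exists C, [/\ Q \subset C, C \subset S, clique e C & #|C| = k.+1].
Proof.
move=> t; elim: t Q => {S e} [S e S_card cS|S e v Q' _ IH vS QS Qk cQ'] Q.
  by move=> QS _; exists S.
move=> Qv cQ; have [vQ|vQ] := boolP (v \in Q).
  exists (v |: Q'); split; first exact: clique_attach_sub Qv vQ cQ.
  - exact: setUS.
  - exact: clique_attach vS QS cQ'.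
  - by rewrite cardsU1 (contra (subsetP QS v) vS) Qk.
have QS' := subset_setU1_notin Qv vQ.
have [C [QC CS cC C_card]] := IH Q QS' ((clique_attach_old _ _ vS QS').1 cQ).
exists C; split=> //; first exact: subset_trans CS (subsetU1 v S).
by apply/(clique_attach_old _ _ vS CS).
Qed.

Lemma ktree_clique_card S e Q : ktree S e -> Q \subset S -> clique e Q -> #|Q| <= k.+1.
Proof.
move=> t; elim: t Q => {S e} [S e S_card cS|S e v Q' _ IH vS QS Qk cQ'] Q.
  by move=> /subset_leq_card; rewrite S_card.
move=> Qv cQ; have [vQ|vQ] := boolP (v \in Q).
  rewrite -Qk; apply: leq_trans (subset_leq_card (clique_attach_sub Qv vQ cQ)) _.
  by rewrite cardsU1; case: (v \notin Q').
have QS' := subset_setU1_notin Qv vQ.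
exact: IH ((clique_attach_old _ _ vS QS').1 cQ).
Qed.

Lemma ktree_closed_degree_gt S e u : ktree S e -> u \in S -> k < closed_degree e S u.
Proof.
move=> t; elim: t u => {S e} [S e S_card cS|S e v Q _ IH vS QS Qk cQ] u.
  move=> uS; rewrite /closed_degree -S_card subset_leq_card //.
  by apply/subsetP => w wS; rewrite inE wS cS.
rewrite !inE; have [-> _|_ /= uS] := eqVneq u v.
  by rewrite closed_degree_attach_new // Qk.
by rewrite closed_degree_attach_old // (leq_trans (IH u uS)) // leq_addl.
Qed.

(** * Low vertices and the total deficit of a [k]-tree *)

Definition low e S Q s := [set u in Q | closed_degree e S u <= k + s].

(** Without the loop, low vertices are those of degree less than [k + s], which lose deficit when a
    vertex is attached to [Q]. The induction compares level [s.+1] after attaching [v] with level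
    [s] or [s.+1] before. *)
Lemma ktree_card_low S e Q s : ktree S e -> k + s < #|S| ->
  Q \subset S -> #|Q| = k -> clique e Q -> #|low e S Q s| <= s.
Proof.
move=> t; elim: t Q s => {S e} [S e S_card cS|S e v Q' t IH vS QS' Qk' cQ'] Q s.
  rewrite S_card ltnS -{2}[k]addn0 leq_add2l leqn0 => /eqP-> QS _ _.
  rewrite leqn0 cards_eq0 -subset0; apply/subsetP => u; rewrite !inE addn0 => /andP[uQ].
  by rewrite leqNgt (ktree_closed_degree_gt (KTreeBase S_card cS)) ?(subsetP QS).
have t' := KTreeAttach t vS QS' Qk' cQ'.
case: s => [|s] + Qv Qk cQ.
  move=> _; rewrite leqn0 cards_eq0 -subset0; apply/subsetP => u; rewrite !inE addn0.
  by case/andP=> uQ; rewrite leqNgt (ktree_closed_degree_gt t') // (subsetP Qv).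
rewrite cardsU1 vS add1n addnS ltnS => s_lt.
have low_step u : u \in S ->
    (closed_degree (attach e v Q') (v |: S) u <= k + s.+1) =
    ((u \in Q') + closed_degree e S u <= k + s.+1).
  by move=> uS; rewrite closed_degree_attach_old.
have [vQ|vQ] := boolP (v \in Q).
  (* Apart from [v], the clique lies in [Q'], where each vertex gains one neighbour; so low at
     [s.+1] now means low at [s] before. *)
  have QvQ' := clique_attach_sub Qv vQ cQ.
  apply: leq_trans (_ : #|v |: low e S Q' s| <= _); last first.
    rewrite cardsU1 -[s.+1]add1n leq_add ?leq_b1 //; exact: IH.
  apply/subset_leq_card/subsetP => u; rewrite !inE => /andP[/(subsetP QvQ')].
  rewrite !inE; have [//|_ /= uQ'] := eqVneq u v.
  by rewrite low_step ?(subsetP QS') // uQ' add1n addnS ltnS.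
have QS := subset_setU1_notin Qv vQ.
have cQe := (clique_attach_old _ _ vS QS).1 cQ.
have [s_lt'|s_ge] := ltnP (k + s.+1) #|S|.
  apply: leq_trans (IH Q s.+1 s_lt' QS Qk cQe).
  apply/subset_leq_card/subsetP => u; rewrite !inE => /andP[uQ].
  rewrite uQ low_step ?(subsetP QS) //; exact: leq_trans (leq_addl _ _).
(* Now [#|S| = k + s + 1]: a vertex that becomes low when [v] is attached is adjacent
   to all of [S] but not to [v], so lies in [U :\: Q']; since [U :|: Q'] is a clique,
   there is at most one such vertex. *)
pose U := [set u in S | closed_degree e S u == #|S|].
have Univ u w : u \in U -> w \in S -> e u w.
  rewrite inE => /andP[uS /eqP uU] wS.
  have /eqP/setP/(_ w) : [set w in S | e u w] == S.
    rewrite eqEcard; apply/andP; split; last by rewrite -uU.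
    by apply/subsetP => x; rewrite inE => /andP[].
  by rewrite inE wS.
have US : U \subset S by apply/subsetP => u; rewrite inE => /andP[].
have cU : clique e (U :|: Q').
  move=> x y; rewrite !in_setU => /orP[xU|xQ] /orP[yU|yQ].
  - by apply: Univ => //; apply: (subsetP US).
  - by apply: Univ => //; apply: (subsetP QS').
  - by rewrite (ktree_sym t (subsetP QS' x xQ) (subsetP US y yU)) Univ // (subsetP QS').
  - exact: cQ'.
have U_Q' : #|U :\: Q'| <= 1.
  have := ktree_clique_card t (_ : U :|: Q' \subset S) cU.
  rewrite subUset US QS' => /(_ isT).
  by rewrite -(cardsID Q' (U :|: Q')) setDUl setDv setU0
     (setIidPr (subsetUr _ _)) Qk' -addn1 leq_add2l.
apply: leq_trans (_ : #|low e S Q s :|: (U :\: Q')| <= _); last first.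
  apply: leq_trans (leq_card_setU _ _) _; rewrite -addn1 leq_add //; exact: IH.
apply/subset_leq_card/subsetP => u; rewrite !inE => /andP[uQ].
have uS := subsetP QS u uQ; rewrite uQ low_step // uS /=.
have : closed_degree e S u <= #|S|.
  by apply/subset_leq_card/subsetP => x; rewrite inE => /andP[].
by case: (u \in Q') => /=; lia.
Qed.

Lemma ktree_deficit S e s : ktree S e -> k + s < #|S| ->
  s * s.+1 <= \sum_(u in S) (k + s.+1 - closed_degree e S u).
Proof.
move=> t; elim: t s => {S e} [S e S_card cS|S e v Q t IH vS QS Qk cQ] s.
  by rewrite S_card ltnS -{2}[k]addn0 leq_add2l leqn0 => /eqP->.
rewrite cardsU1 vS add1n ltnS => s_le.
rewrite big_setU1 //= closed_degree_attach_new // Qk.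
rewrite (eq_bigr (fun u => k + s.+1 - ((u \in Q) + closed_degree e S u))); last first.
  by move=> u uS; rewrite closed_degree_attach_old.
have [s_lt|s_ge] := ltnP (k + s) #|S|.
  have := ktree_card_low t s_lt QS Qk cQ; have := IH s s_lt.
  have -> : #|low e S Q s| = \sum_(u in S) ((u \in Q) && (closed_degree e S u <= k + s)).
    rewrite -sum1_card -big_mkcondr; apply: eq_bigl => u; rewrite !inE.
    by case: (boolP (u \in Q)) => [/(subsetP QS)->//|]; rewrite andbF.
  set A := \sum_(u in S) _; set L := \sum_(u in S) _; set A' := \sum_(u in S) _.
  suff : A <= A' + L by lia.
  rewrite -big_split; apply: leq_sum => u _ /=.
  by case: (u \in Q) => /=; lia.
(* Now the old [#|S|] is [k + s], too small for the induction hypothesis at [s], so the level drops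
   by one. With [s] renamed, raising the level again adds 1 on [S :\: Q], which has [s.+1] vertices,
   and cancels on [Q] with the new edges. Together with the deficit [s.+1] of [v], this adds
   [2 * s.+1] to [s * s.+1]. *)
case: s s_le s_ge => [//|s] s_le s_ge.
have := IH s; set A := \sum_(u in S) _; set A' := \sum_(u in S) _.
suff : A' = A + #|S :\: Q|.
  by rewrite cardsD (setIidPr QS) Qk; nia.
rewrite -sum1_card [A'](big_setID Q) /= [A](big_setID Q) /= (setIidPr QS) -addnA -big_split /=.
congr (_ + _); apply: eq_bigr => u; first by move=> ->; lia.
rewrite !inE => /andP[/negbTE-> uS].
(* Since [#|S| = k + s.+1], the truncated subtractions are exact here. *)
have : closed_degree e S u <= #|S|.
  by apply/subset_leq_card/subsetP => x; rewrite inE => /andP[].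
by rewrite /=; lia.
Qed.

(** * Completing a graph to a [k]-tree *)

Lemma subset_of_card (A C : {set V}) n : A \subset C -> #|A| <= n <= #|C| ->
  exists Q : {set V}, [/\ A \subset Q, Q \subset C & #|Q| = n].
Proof.
move=> AC; elim: n => [|n IHn] /andP[An nC].
  by exists A; split=> //; apply/eqP; rewrite -leqn0.
have [An'|An'] := leqP #|A| n; last by exists A; split=> //; apply/eqP; rewrite eqn_leq An.
have [|Q [AQ QC Qn]] := IHn; first by rewrite An' ltnW.
have /properP[_ [x xC xQ]] : Q \proper C by rewrite properEcard QC Qn.
exists (x |: Q); split; last by rewrite cardsU1 xQ Qn.
  exact: subset_trans AQ (subsetU1 x Q).
by rewrite subUset sub1set xC.
Qed.

(** Delete a simplicial vertex [v] and complete the rest. The remaining neighbours of [v], at most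
    [k] as [h v v] counts [v] itself, form a clique; it extends to a [k.+1]-clique, and a [k]-subset
    of that containing them receives [v]. *)
Lemma ktree_completion (h : rel V) S : reflexive h -> symmetric h ->
    (forall S', S' != set0 -> exists2 v, v \in S' &
       clique h [set u in S' | h v u] /\ #|[set u in S' | h v u]| <= k.+1) ->
  k < #|S| -> exists2 e, ktree S e & {in S &, subrel h e}.
Proof.
move=> h_refl h_sym simpl kS.
move: (#|S| - k.+1) (subnK kS) => n; elim: n S {kS} => [|n IHn] S nS.
  by exists (fun _ _ => true) => //; apply: KTreeBase.
have [|v vS [cN N_le]] := simpl S; first by rewrite -card_gt0 -nS.
have S'_card : #|S :\ v| = n + k.+1 by move: nS; rewrite (cardsD1 v) vS; lia.
have [e t he] := IHn (S :\ v) (esym S'_card).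
pose N := [set u in S :\ v | h v u].
have NS : N \subset S :\ v by apply/subsetP => u; rewrite inE => /andP[].
have N_sub : N \subset [set u in S | h v u] :\ v.
  by apply/subsetP => u; rewrite !inE -!andbA.
have N_k : #|N| <= k.
  move: N_le; rewrite (cardsD1 v) inE vS h_refl add1n ltnS.
  exact: leq_trans (subset_leq_card N_sub).
have cNe : clique e N.
  move=> x y xN yN; apply: he; rewrite ?(subsetP NS) //.
  by apply: cN; apply: (subsetP (subset_trans N_sub (subD1set _ _))).
have [C [NC CS cC C_card]] := ktree_clique_extend t NS cNe.
have [|Q [NQ QC Qk]] := subset_of_card NC (n := k); first by rewrite N_k C_card leqnSn.
exists (attach e v Q).
  rewrite -(setD1K vS); apply: KTreeAttach => //.
  - by rewrite !inE eqxx.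
  - exact: subset_trans CS.
  - exact: sub_clique cC.
have hQ x : x \in S -> x != v -> h v x -> x \in Q.
  by move=> xS xv vx; apply: (subsetP NQ); rewrite !inE xv xS.
move=> x y xS yS xy; rewrite /attach !inE.
have [xv|xv] := eqVneq x v.
  by have [//|yv] := eqVneq y v; rewrite hQ // -xv.
have [yv|yv] := eqVneq y v; first by rewrite hQ // -yv h_sym.
by apply: he; rewrite ?inE ?xv ?yv.
Qed.

End KTree.

(** * From deficits to the edge bound *)

Lemma not_overfull (G : sgraph) k s : has_tree_decomposition G k ->
  max_degree G = k + s -> k <= s * s -> ~ overfull G.
Proof.
case=> [T [B [tdB wB]]] Delta ks [n_odd]; rewrite ltnNge => /negP[].
have le_Delta (x : G) : degree x <= k + s by rewrite -Delta; exact: leq_bigmax.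
have n_gt0 : 0 < #|G| := odd_gt0 n_odd.
have [x0 x0_max] := eq_bigmax (@degree G) n_gt0.
(* A vertex of maximum degree is not its own neighbour. *)
have n_gt : k + s < #|[set: G]|.
  rewrite -Delta /max_degree x0_max cardsT (cardD1 x0) inE ltnS.
  apply/subset_leq_card/subsetP => y; rewrite !inE andbT => xy.
  by apply/eqP => yx0; rewrite yx0 adj_irrefl in xy.
have simpl (S : {set G}) : S != set0 -> exists2 v, v \in S &
    clique (share B) [set u in S | share B v u] /\ #|[set u in S | share B v u]| <= k.+1.
  case/(share_simplicial tdB) => v vS [q vq]; exists v => //.
  have sub_q : [set u in S | share B v u] \subset B q.
    by apply/subsetP => u; rewrite inE => /andP[]; apply: vq.
  split; last by apply: leq_trans (subset_leq_card sub_q) _; rewrite -addn1; apply: wB.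
  by move=> x y /(subsetP sub_q) xq /(subsetP sub_q) yq; apply/existsP; exists q; rewrite xq.
have [e t share_e] := ktree_completion (share_refl tdB) (@share_sym _ _ B) simpl
  (leq_ltn_trans (leq_addr s k) n_gt).
have degree_e (x : G) : degree x < closed_degree e setT x.
  rewrite /closed_degree (cardsD1 x) !inE share_e ?inE ?share_refl // add1n ltnS.
  apply/subset_leq_card/subsetP => y; rewrite !inE => xy.
  rewrite (share_e x y) ?inE ?(adj_share tdB xy) //=.
  by rewrite andbT; apply: contraTneq xy => ->; rewrite adj_irrefl.
have deficit := ktree_deficit t n_gt.
have deficit_le : \sum_(x in [set: G]) (k + s.+1 - closed_degree e setT x) + \sum_(x : G) degree x
    <= #|G| * (k + s).
  rewrite (eq_bigl xpredT) => [|x]; last by rewrite inE.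
  rewrite -big_split -sum_nat_const; apply: leq_sum => x _ /=.
  by have := degree_e x; have := le_Delta x; lia.
(* With [n = 2h + 1], doubling the edge count gives [s(s + 1) + 2|E| <= (2h + 1)(k + s)]; as
   [k + s <= s(s + 1)], this leaves [|E| <= h(k + s)]. *)
pose h := (#|G| - 1)./2.
have n_half : #|G| = h.*2.+1.
  by rewrite /h; move: (odd_double_half #|G|); rewrite n_odd; lia.
have := double_card_edges_le G; rewrite Delta divn2 -/h [_ * h]mulnC.
move: deficit deficit_le; rewrite n_half mulSn -doubleMl mulnS.
lia.
Qed.

Theorem lemma5 (R : realType) (G : sgraph) (k : nat) :
  treewidth G <= k ->
  (k%:R + Num.sqrt (k%:R) <= (max_degree G)%:R :> R)%R ->
  ~ overfull G.
Proof.
move=> /treewidth_leP twG Delta_ge.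
have sqrt_ge0 : (0 <= Num.sqrt (k%:R : R))%R := Num.Theory.sqrtr_ge0 _.
have k_le : k <= max_degree G.
  rewrite -(Num.Theory.ler_nat R); apply: Order.POrderTheory.le_trans Delta_ge.
  by rewrite Num.Theory.lerDl.
(* By [k_le] the subtraction is exact, and squaring [sqrt k <= Delta - k] gives [k <= s * s]. *)
apply: (@not_overfull _ k (max_degree G - k)) => //; first by rewrite subnKC.
rewrite -(Num.Theory.ler_nat R) GRing.natrM GRing.natrB // -GRing.expr2.
rewrite -[X in (X <= _)%R](@Num.Theory.sqr_sqrtr R) ?Num.Theory.ler0n //.
by rewrite Num.Theory.lerXn2r ?Num.Theory.nnegrE ?Num.Theory.subr_ge0
   ?Num.Theory.ler_nat // Num.Theory.lerBrDl.
Qed.
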